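(* Let $T$, $\widehat T$, $\widehat{\mathcal L}$, $\widehat C$, $C^r$ be as described in the context, so that $\widehat{\mathcal L}$ is $\widehat C$-normal; that is, for every $r\in\mathbb N$ the subspace $M_{3,r}(\widehat{\mathcal L}_r)\subset M_3[\mathbb C]$ is $C^r$-normal, with parameters $p_{1,r},p_{2,r},q_{2,r},q_{3,r}\in\mathbb C\setminus\{0\}$. Then for every $r\in\mathbb N$ we have (i) $q_{3,r}=q_{2,r}\,q_{2,r+1}\,\rho(C^{r+1}_{3,1})$, (ii) $p_{1,r+1}=p_{2,r}\,p_{2,r+1}\,\rho(C^{r}_{1,1})$.
   Context: Notation. $\mathbb N=\{1,2,\dots\}$, $\mathbb N_3=\{1,2,3\}$, $\mathbb C_0=\mathbb C\setminus\{0\}$. $\mathcal L(\mathcal K)$ is the algebra of bounded linear operators on a Hilbert space $\mathcal K$; $\{T\}'$ is the commutant of $T$; $\sigma_{\rm p}$ denotes point spectrum, $\sigma$ spectrum, and $\rho(A)=\mathbb C\setminus\sigma(A)$ the resolvent set of an operator $A$. $\mathcal H$ is a complex Hilbert space with a fixed orthonormal basis $\{e_k\}_{k=1}^\infty$, $\mathcal H^{(4)}=\mathcal H\oplus\mathcal H\oplus\mathcal H\oplus\mathcal H$, and $e_k\otimes e_k$ is the orthogonal projection onto $\mathbb C e_k$. Setting. $\mathcal H_1,\mathcal H_2$ are complex Hilbert spaces of dimension $\aleph_0$ and $T=\begin{bmatrix}A&C\\ 0&B\end{bmatrix}\in\mathcal L(\mathcal H_1\oplus\mathcal H_2)$ is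 not a scalar multiple of the identity, $\sigma_{\rm p}(T)=\sigma_{\rm p}(T^* )=\emptyset$, and $\{T\}'x$ is dense in $\mathcal H_1\oplus\mathcal H_2$ for every nonzero $x\in\mathcal H_1$ ($\equiv\mathcal H_1\oplus\{0\}$). Fix $\lambda_0\in\partial\sigma(A)$ and $\mu_0\in\partial\sigma(B)$. $T-\mu_0 I$ is similar to an operator $\widehat T\in\mathcal L(\mathcal H^{(4)})$ of the form $$\widehat T=\begin{bmatrix} D&*&*&* \\ F&*&*&* \\ 0&0&*&* \\ 0&0&F_*&D_* \end{bmatrix},$$ where $D=\sum_{k}(\lambda_k-\mu_0)e_k\otimes e_k$ with $\rho(A)\ni\lambda_k\to\lambda_0$, $D_*=\sum_k(\mu_k-\mu_0)e_k\otimes e_k$ with $\rho(B)\ni\mu_k\to\mu_0$ (both convergences fast enough for such a similarity model to be constructed), $\{\lambda_k\}_{k=1}^\infty\cup\{\mu_k\}_{k=1}^\infty$ consists of distinct nonzero points, and $\operatorname{rank}F=\operatorname{rank}F_*=1$. Let $$\widehat{\mathcal L}=\{Q_{4,1}:[Q_{i,j}]_4\in\{\widehat T\}'\}\subset\mathcal L(\mathcal H),$$ which is transitive (i.e. $\widehat{\mathcal L}x$ is dense in $\mathcal H$ for every nonzero $x\in\mathcal H$) and satisfies $\operatorname{rank}(D_*\widehat X-\widehat XD)\le 2$ for all $\widehat X\in\widehat{\mathcal L}$. Put $b_i=\mu_i-\mu_0$, $a_j=\lambda_j-\mu_0$, $\widehat c_{i,j}=b_i-a_j$, $\widehat C=[\widehat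 c_{i,j}]_{i,j=1}^\infty$, and, for $r\in\mathbb N$, $C^r=[c^r_{i,j}]_3$ with $c^r_{i,j}=\widehat c_{r+i-1,r+j-1}$ ($i,j\in\mathbb N_3$). Cross-sections. For $r\in\mathbb N$ let $\mathcal E_{3,r}$ be the span of $e_r,e_{r+1},e_{r+2}$; $\widehat{\mathcal L}_r\subset\mathcal L(\mathcal E_{3,r})$ is the set of compressions $P_{\mathcal E_{3,r}}\widehat X|_{\mathcal E_{3,r}}$, $\widehat X\in\widehat{\mathcal L}$, with $P_{\mathcal E_{3,r}}$ the orthogonal projection onto $\mathcal E_{3,r}$; and $M_{3,r}:\mathcal L(\mathcal E_{3,r})\to M_3[\mathbb C]$ assigns to an operator its matrix in the basis $(e_r,e_{r+1},e_{r+2})$. $C$-normality. For a matrix $C\in M_3[\mathbb C]$ and $k,l\in\mathbb N_3$, $C_{k,l}\in M_2[\mathbb C]$ is obtained from $C$ by deleting its $k$-th row and $l$-th column (so $C^r_{k,l}$ is obtained in this way from $C^r$). For $Y=[\eta_{i,j}]_2\in M_2[\mathbb C_0]$ put $\rho(Y)=\dfrac{\eta_{1,1}\eta_{2,2}}{\eta_{1,2}\eta_{2,1}}$. For $C\in M_3[\mathbb C_0]$ a subspace $\mathcal L\subset M_3[\mathbb C]$ is $C$-normal with parameters $p_1,p_2,q_2,q_3\in\mathbb C_0$ if $\dim\mathcal L=5$ and $\mathcal L$ has a basis $(L_1,L_2,Q_1,Q_2,Q_3)$ of the form $$L_1=\begin{bmatrix} 1&0&0 \\ \rho(C_{3,2})q_2&0&0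 \\ \rho(C_{2,2})q_3&0&0 \end{bmatrix},\quad L_2=\begin{bmatrix} 0&1&0 \\ 0&\rho(C_{3,1})q_2&0 \\ 0&\rho(C_{2,1})q_3&0 \end{bmatrix},\quad Q_1=\begin{bmatrix} 0&0&1 \\ 0&0&q_2 \\ 0&0&q_3 \end{bmatrix},$$ $$Q_2=\begin{bmatrix} 0&0&0 \\ p_1&p_2&1 \\ 0&0&0 \end{bmatrix},\quad Q_3=\begin{bmatrix} 0&0&0 \\ 0&0&0 \\ \rho(C_{1,2})p_1&\rho(C_{1,1})p_2&1 \end{bmatrix}.$$ $\widehat{\mathcal L}$ is called $\widehat C$-normal if $M_{3,r}(\widehat{\mathcal L}_r)$ is $C^r$-normal (with parameters $p_{1,r},p_{2,r},q_{2,r},q_{3,r}$) for every $r\in\mathbb N$. In the setting above $\widehat{\mathcal L}$ is known, from earlier work, to be $\widehat C$-normal; this is part of the standing setting. *)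

(* Defs.v *)
From HB Require Import structures.
From mathcomp Require Import all_boot all_order all_algebra sesquilinear complex.
From mathcomp Require Import all_classical all_reals all_analysis.
Import Order.TTheory GRing.Theory Num.Theory numFieldNormedType.Exports.

Set Implicit Arguments.
Unset Strict Implicit.
Unset Printing Implicit Defensive.

Local Open Scope classical_set_scope.
Local Open Scope ring_scope.

(* All families indexed by {1, 2, ...} in the mathematics (basis vectors, the
   sequences lambda_k and mu_k, the cross-sections, rows and columns) are
   indexed from 0 here. *)

(* The field R[i], seen through the structure that carries its topology. *)
Definition cplx (R : realType) : numClosedFieldType := complex R.

(* [dotp] is linear in its first argument and conjugate-linear in the second. *)
HB.mixin Record CompleteNormedModule_isHilbert (R : realType) V
    & CompleteNormedModule (cplx R) V := {
  dotp : {dot V for @Num.conj (cplx R)};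
  dotp_norm : forall x : V, dotp x x = `|x| ^+ 2
}.

#[short(type="hilbertType")]
HB.structure Definition Hilbert (R : realType) :=
  {V of CompleteNormedModule (cplx R) V & CompleteNormedModule_isHilbert R V}.

(* The rank-one operator e (x) e, i.e. x |-> <x, e> e. *)
Definition tensor (R : realType) (H : hilbertType R) (e x : H) : H :=
  dotp x e *: e.

Definition orthonormal_basis (R : realType) (H : hilbertType R)
    (e : nat -> H) : Prop :=
  (forall i j, dotp (e i) (e j) = (i == j)%:R) /\
  (forall x, [series tensor (e k) x]_k @ \oo --> x).

Definition dim_aleph0 (R : realType) (H : hilbertType R) : Prop :=
  exists e : nat -> H, orthonormal_basis e.

(* The product H1 * H2 is normed by the library with the maximum norm, which is
   equivalent to the Hilbert norm of the orthogonal sum: continuity, density,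
   spectra and similarity do not see the difference. Only adjoints depend on the
   inner product, which is the following one. *)
Definition dsum_dotp (R : realType) (H1 H2 : hilbertType R)
    (x y : H1 * H2) : cplx R :=
  dotp x.1 y.1 + dotp x.2 y.2.

Definition is_adjoint (R : realType) (H1 H2 : hilbertType R)
    (T Ts : H1 * H2 -> H1 * H2) : Prop :=
  forall x y, dsum_dotp (T x) y = dsum_dotp x (Ts y).

(* Bounded operators are linear maps together with a continuity hypothesis. *)

Definition commutant (R : realType) (V : normedModType (cplx R))
    (T : V -> V) : set {linear V -> V} :=
  [set X | continuous X /\ forall x, X (T x) = T (X x)].

Definition point_spectrum (R : realType) (V : normedModType (cplx R))
    (T : V -> V) : set (cplx R) :=
  [set l | exists2 x, x != 0 & T x = l *: x].

Definition resolvent_set (R : realType) (V : normedModType (cplx R))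
    (T : V -> V) : set (cplx R) :=
  [set l | exists S : {linear V -> V}, [/\ continuous S,
     cancel (fun x => T x - l *: x) S & cancel S (fun x => T x - l *: x)]].

Definition spectrum (R : realType) (V : normedModType (cplx R))
    (T : V -> V) : set (cplx R) := ~` resolvent_set T.

Definition frontier (T : topologicalType) (A : set T) : set T :=
  closure A `\` interior A.

Definition similar_op (R : realType) (V W : normedModType (cplx R))
    (X : V -> V) (Y : W -> W) : Prop :=
  exists (S : {linear V -> W}) (S' : {linear W -> V}),
    [/\ continuous S, continuous S', cancel S S', cancel S' S
      & forall x, S (X x) = Y (S x)].

Definition has_rank (R : realType) (V W : normedModType (cplx R))
    (X : V -> W) (n : nat) : Prop :=
  exists v : 'I_n -> W,
    (forall c : 'I_n -> cplx R, \sum_i c i *: v i = 0 -> forall i, c i = 0) /\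
    range X = [set w | exists c : 'I_n -> cplx R, w = \sum_i c i *: v i].

(* X is the (strongly convergent) sum of a_k (e_k (x) e_k). *)
Definition is_diagonal (R : realType) (H : hilbertType R) (e : nat -> H)
    (a : nat -> cplx R) (X : H -> H) : Prop :=
  forall x, [series a k *: tensor (e k) x]_k @ \oo --> X x.

Definition transitive_family (R : realType) (V : normedModType (cplx R))
    (L : set (V -> V)) : Prop :=
  forall x, x <> 0 -> dense [set X x | X in L].

Definition sum4 (R : realType) (H : hilbertType R) : normedModType (cplx R) :=
  (H * H * H * H)%type.

Definition coord4 (R : realType) (H : hilbertType R) (i : 'I_4)
    (x : sum4 H) : H :=
  let: (x0, x1, x2, x3) := x in nth 0 [:: x0; x1; x2; x3] i.

Definition inj4 (R : realType) (H : hilbertType R) (j : 'I_4)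
    (x : H) : sum4 H :=
  (x *+ (j == 0), x *+ (j == 1), x *+ (j == 2), x *+ (j == 3)).

Definition block (R : realType) (H : hilbertType R) (Q : sum4 H -> sum4 H)
    (i j : 'I_4) : H -> H :=
  fun x => coord4 i (Q (inj4 j x)).

Definition corner_family (R : realType) (H : hilbertType R)
    (That : sum4 H -> sum4 H) : set (H -> H) :=
  [set block Q 3 0 | Q in commutant That].

(* The orthogonal projection onto the span of e_r, e_(r+1), e_(r+2). *)
Definition proj3 (R : realType) (H : hilbertType R) (e : nat -> H) (r : nat)
    (x : H) : H :=
  \sum_(i < 3) tensor (e (r + i)%N) x.

(* The matrix, in the orthonormal basis (e_r, e_(r+1), e_(r+2)), of an operator
   that maps the span of these vectors into itself. *)
Definition mat3 (R : realType) (H : hilbertType R) (e : nat -> H) (r : nat)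
    (Y : H -> H) : 'M[cplx R]_3 :=
  \matrix_(i, j) dotp (Y (e (r + j)%N)) (e (r + i)%N).

Definition cross_section (R : realType) (H : hilbertType R) (e : nat -> H)
    (r : nat) (L : set (H -> H)) : set 'M[cplx R]_3 :=
  [set mat3 e r (proj3 e r \o X) | X in L].

Definition rho (K : fieldType) (Y : 'M[K]_2) : K :=
  (Y 0 0 * Y 1 1) / (Y 0 1 * Y 1 0).

Definition del (K : fieldType) (C : 'M[K]_3) (k l : 'I_3) : 'M[K]_2 :=
  row' k (col' l C).

Definition mx3 (K : fieldType) (s : seq (seq K)) : 'M[K]_3 :=
  \matrix_(i, j) nth 0 (nth [::] s i) j.

Definition C_normal (K : fieldType) (C : 'M[K]_3) (L : set 'M[K]_3)
    (p1 p2 q2 q3 : K) : Prop :=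
  [/\ p1 != 0, p2 != 0, q2 != 0, q3 != 0
    & exists V : {vspace 'M[K]_3}, [/\ L = [set` V], \dim V = 5%N &
      basis_of V
       [:: mx3 [:: [:: 1; 0; 0];
                   [:: rho (del C 2 1) * q2; 0; 0];
                   [:: rho (del C 1 1) * q3; 0; 0]];
           mx3 [:: [:: 0; 1; 0];
                   [:: 0; rho (del C 2 0) * q2; 0];
                   [:: 0; rho (del C 1 0) * q3; 0]];
           mx3 [:: [:: 0; 0; 1];
                   [:: 0; 0; q2];
                   [:: 0; 0; q3]];
           mx3 [:: [:: 0; 0; 0];
                   [:: p1; p2; 1];
                   [:: 0; 0; 0]];
           mx3 [:: [:: 0; 0; 0];
                   [:: 0; 0; 0];
                   [:: rho (del C 0 1) * p1; rho (del C 0 0) * p2; 1]]]]].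

(* The matrix C^r with entries c_(i,j) = b_i - a_j, r <= i, j <= r + 2, where
   b_i = mu_i - mu0 and a_j = lambda_j - mu0. *)
Definition Cmx (K : fieldType) (lam mu : nat -> K) (mu0 : K) (r : nat) :
    'M[K]_3 :=
  \matrix_(i, j) ((mu (r + i)%N - mu0) - (lam (r + j)%N - mu0)).

(* Main.v *)
Require Import Defs.
From mathcomp Require Import all_boot all_order all_algebra sesquilinear complex.
From mathcomp Require Import all_classical all_reals all_analysis.
From mathcomp Require Import ring.
Import Order.TTheory GRing.Theory Num.Theory numFieldNormedType.Exports.

Set Implicit Arguments.
Unset Strict Implicit.
Unset Printing Implicit Defensive.

Local Open Scope classical_set_scope.
Local Open Scope ring_scope.

(** The windows r and r+1 of the infinite matrix of an operator X in the corner
family share a 2 x 2 block: it is the lower right block of the window r and the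
upper left block of the window r+1.

A C-normal space constrains upper left 2 x 2 blocks. The basis elements L_1 and
L_2 fix the second row in terms of the first one up to a multiple of (p_1, p_2),
and eliminating this multiple leaves one linear relation
([C_normal_relation]). So the parameters of the window r+1 impose a relation on
the lower right block of every matrix occurring in the window r. That window
contains in particular Q_1 and Q_2, whose lower right blocks have rows (0, q_2),
(0, q_3) and (p_2, 1), (0, 0). Tested on Q_1, the relation is identity (i);
tested on Q_2, it is identity (ii), except that rho(C_{3,1}) and rho(C_{3,2})
are those of the window r+1. Their quotient is rho(C_{3,3}) ([rho_del_mul]), and
deleting the last row and column of the window r+1 leaves the same block of the
matrix b_i - a_j as deleting the first row and column of the window r. *)

Section CNormal.
Variables (K : fieldType) (C : 'M[K]_3) (L : set 'M[K]_3) (p1 p2 q2 q3 : K).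
Hypothesis nL : C_normal C L p1 p2 q2 q3.

Lemma C_normal_Q1 : L (mx3 [:: [:: 0; 0; 1]; [:: 0; 0; q2]; [:: 0; 0; q3]]).
Proof.
case: nL => _ _ _ _ [V [-> _ /basis_mem bV]].
by apply: bV; rewrite !inE eqxx !orbT.
Qed.

Lemma C_normal_Q2 : L (mx3 [:: [:: 0; 0; 0]; [:: p1; p2; 1]; [:: 0; 0; 0]]).
Proof.
case: nL => _ _ _ _ [V [-> _ /basis_mem bV]].
by apply: bV; rewrite !inE eqxx !orbT.
Qed.

(** Subtracting from the second row the part that L_1 and L_2 attach to the
first row leaves a multiple of (p_1, p_2), by the coefficient of Q_2; the
relation says that the two remainders are in this proportion. *)
Lemma C_normal_relation (M : 'M[K]_3) : L M ->
  p2 * (M 1 0 - rho (del C 2 1) * q2 * M 0 0) =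
  p1 * (M 1 1 - rho (del C 2 0) * q2 * M 0 1).
Proof.
case: nL => _ _ _ _ [V [-> _ /span_basis spanV]] /=.
rewrite -spanV => /(@coord_span _ _ _ (in_tuple _)) ->.
rewrite !big_ord_recl big_ord0 !mxE /=.
ring.
Qed.

End CNormal.

(** The three cross ratios of the first two rows of C, one for each pair of
columns, form a multiplicative cocycle. *)
Lemma rho_del_mul (K : fieldType) (C : 'M[K]_3) :
  C 0 1 != 0 -> C 1 1 != 0 ->
  rho (del C 2 1) = rho (del C 2 0) * rho (del C 2 2).
Proof.
have del21 i j : del C 2 i 0 j = C 0 (lift i j).
  by rewrite !mxE; congr (C _ _); apply: val_inj.
have del21' i j : del C 2 i 1 j = C 1 (lift i j).
  by rewrite !mxE; congr (C _ _); apply: val_inj.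
rewrite /rho !del21 !del21'.
have -> : lift 1 0 = 0 :> 'I_3 by apply: val_inj.
have -> : lift 1 1 = 2 :> 'I_3 by apply: val_inj.
have -> : lift 0 0 = 1 :> 'I_3 by apply: val_inj.
have -> : lift 0 1 = 2 :> 'I_3 by apply: val_inj.
have -> : lift 2 0 = 0 :> 'I_3 by apply: val_inj.
have -> : lift 2 1 = 1 :> 'I_3 by apply: val_inj.
move=> C01 C11; rewrite !invfM.
rewrite [RHS](_ : _ = C 0 0 * C 1 2 / C 0 2 / C 1 0 *
  (C 0 1 / C 0 1) * (C 1 1 / C 1 1)); last by ring.
by rewrite !divff // !mulr1 !mulrA.
Qed.

Lemma rho_neq0 (K : fieldType) (Y : 'M[K]_2) :
  (forall i j, Y i j != 0) -> rho Y != 0.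
Proof. by move=> Y0; rewrite /rho !(mulf_neq0, invr_neq0). Qed.

(** The purely algebraic form of the result. The primed data are those of the
next window, and the hypothesis on L expresses the overlap of the windows. *)
Lemma C_normal_overlap (K : fieldType) (C C' : 'M[K]_3) (L L' : set 'M[K]_3)
    (p1 p2 q2 q3 p1' p2' q2' q3' : K) :
  C_normal C L p1 p2 q2 q3 -> C_normal C' L' p1' p2' q2' q3' ->
  (forall i j, C' i j != 0) -> del C' 2 2 = del C 0 0 ->
  (forall M, L M -> exists2 M', L' M' & del M' 2 2 = del M 0 0) ->
  q3 = q2 * q2' * rho (del C' 2 0) /\ p1' = p2 * p2' * rho (del C 0 0).
Proof.
move=> nL nL' C'0 delC overlap.
have [p1'0 p2'0 q2'0 _ _] := nL'.
have relation M : L M ->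
    p2' * (del M 0 0 1 0 - rho (del C' 2 1) * q2' * del M 0 0 0 0) =
    p1' * (del M 0 0 1 1 - rho (del C' 2 0) * q2' * del M 0 0 0 1).
  move=> /overlap[M' /(C_normal_relation nL') + <-]; rewrite !mxE.
  have -> : lift 2 0 = 0 :> 'I_3 by apply: val_inj.
  by have -> : lift 2 1 = 1 :> 'I_3 by apply: val_inj.
have := relation _ (C_normal_Q2 nL); have := relation _ (C_normal_Q1 nL).
rewrite rho_del_mul // delC !mxE /= => relQ1 relQ2; split.
  rewrite !mulr0 subrr mulr0 in relQ1.
  apply: (mulfI p1'0); apply/subr0_eq; rewrite [RHS]relQ1; ring.
have rq0 : rho (del C' 2 0) * q2' != 0.
  by rewrite mulf_neq0 // rho_neq0 // => i j; rewrite !mxE.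
apply: (mulfI rq0); apply: oppr_inj.
transitivity (p1' * (0 - rho (del C' 2 0) * q2' * 1)); first by ring.
rewrite -relQ2; ring.
Qed.

Lemma mat3_proj3 (R : realType) (H : hilbertType R) (e : nat -> H) (r : nat)
    (X : H -> H) : orthonormal_basis e ->
  mat3 e r (proj3 e r \o X) = mat3 e r X.
Proof.
case=> e_on _; apply/matrixP => i j; rewrite !mxE /= /proj3 /tensor.
rewrite linear_sumlz /= (bigD1 i) //= linearZl_LR /= e_on eqxx.
rewrite big1 ?addr0 => [|k kNi]; first by rewrite [LHS]mulr1.
by rewrite linearZl_LR /= e_on eqn_add2l (inj_eq val_inj) (negPf kNi) [LHS]mulr0.
Qed.

Lemma del_mat3_succ (R : realType) (H : hilbertType R) (e : nat -> H)
    (r : nat) (X : H -> H) : del (mat3 e r.+1 X) 2 2 = del (mat3 e r X) 0 0.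
Proof.
by apply/matrixP => [[[|[|//]] ?] [[|[|//]] ?]]; rewrite !mxE /= !addSnnS.
Qed.

Lemma del_Cmx_succ (K : fieldType) (lam mu : nat -> K) (mu0 : K) (r : nat) :
  del (Cmx lam mu mu0 r.+1) 2 2 = del (Cmx lam mu mu0 r) 0 0.
Proof.
by apply/matrixP => [[[|[|//]] ?] [[|[|//]] ?]]; rewrite !mxE /= !addSnnS.
Qed.

Theorem theorem4 (R : realType) (H1 H2 H : hilbertType R)
  (dimH1 : dim_aleph0 H1) (dimH2 : dim_aleph0 H2)
  (e : nat -> H) (e_basis : orthonormal_basis e)
  (* the operator T and its triangular form *)
  (A : {linear H1 -> H1}) (B : {linear H2 -> H2}) (C : {linear H2 -> H1})
  (contA : continuous A) (contB : continuous B) (contC : continuous C)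
  (T : {linear (H1 * H2)%type -> (H1 * H2)%type})
  (T_form : forall x y, T (x, y) = (A x + C y, B y))
  (T_nonscalar : ~ exists c : cplx R, forall x, T x = c *: x)
  (T_point : point_spectrum T = set0)
  (Ts : {linear (H1 * H2)%type -> (H1 * H2)%type})
  (Ts_adjoint : is_adjoint T Ts)
  (Ts_point : point_spectrum Ts = set0)
  (T_dense : forall x : H1, x <> 0 ->
     dense [set (X : {linear _ -> _}) (x, 0) | X in commutant T])
  (* the points lambda_k and mu_k *)
  (lam0 mu0 : cplx R)
  (lam0_bd : frontier (spectrum A) lam0)
  (mu0_bd : frontier (spectrum B) mu0)
  (lam mu : nat -> cplx R)
  (lam_res : forall k, resolvent_set A (lam k))
  (mu_res : forall k, resolvent_set B (mu k))
  (lam_cvg : lam @ \oo --> lam0) (mu_cvg : mu @ \oo --> mu0)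
  (lam_inj : injective lam) (mu_inj : injective mu)
  (lam_mu : forall i j, lam i != mu j)
  (lam_neq0 : forall k, lam k != 0) (mu_neq0 : forall k, mu k != 0)
  (* the similarity model *)
  (That : {linear sum4 H -> sum4 H}) (contThat : continuous That)
  (T_similar : similar_op (fun x : H1 * H2 => T x - mu0 *: x) That)
  (That_20 : forall x, block That 2 0 x = 0)
  (That_30 : forall x, block That 3 0 x = 0)
  (That_21 : forall x, block That 2 1 x = 0)
  (That_31 : forall x, block That 3 1 x = 0)
  (That_D : is_diagonal e (fun k => lam k - mu0) (block That 0 0))
  (That_Ds : is_diagonal e (fun k => mu k - mu0) (block That 3 3))
  (That_F : has_rank (block That 1 0) 1)
  (That_Fs : has_rank (block That 3 2) 1)
  (Lhat_transitive : transitive_family (corner_family That))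
  (Lhat_rank : forall X, corner_family That X ->
     exists2 n, (n <= 2)%N &
       has_rank (fun x => block That 3 3 (X x) - X (block That 0 0 x)) n)
  (p1 p2 q2 q3 : nat -> cplx R)
  (Lhat_normal : forall r,
     C_normal (Cmx lam mu mu0 r) (cross_section e r (corner_family That))
       (p1 r) (p2 r) (q2 r) (q3 r))
  (r : nat) :
  q3 r = q2 r * q2 r.+1 * rho (del (Cmx lam mu mu0 r.+1) 2 0) /\
  p1 r.+1 = p2 r * p2 r.+1 * rho (del (Cmx lam mu mu0 r) 0 0).
Proof.
apply: (C_normal_overlap (Lhat_normal r) (Lhat_normal r.+1)).
- by move=> i j; rewrite mxE opprB addrA subrK subr_eq0 eq_sym.
- exact: del_Cmx_succ.
move=> _ [X LX <-]; exists (mat3 e r.+1 (proj3 e r.+1 \o X)); first by exists X.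
by rewrite !mat3_proj3 // del_mat3_succ.
Qed.
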